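(* Let $k>2$ and $m$ be positive integers, let $\zeta_k$ be a primitive $k$-th root of unity, and let $\Phi_k$ denote the $k$-th cyclotomic polynomial. If $m\geq\phi(k)+1$ (where $\phi$ is Euler's totient function), then $(-m+\zeta_k,\mathcal{N})$ is a canonical number system, where $\mathcal{N}=\{0,1,\dots,|\Phi_k(m)|-1\}$.
   Context: For a monic polynomial $P=X^d+p_{d-1}X^{d-1}+\cdots+p_1X+p_0\in\mathbb{Z}[X]$ let $\mathcal{R}=\mathbb{Z}[X]/P(X)\mathbb{Z}[X]$ and $\mathcal{N}=\{0,1,\ldots,|p_0|-1\}$. The pair $(P,\mathcal{N})$ is called a canonical number system if every element $\gamma\in\mathcal{R}$ has a unique representation of the form $\gamma=\sum_{j\geq0}a_jX^j$ with $a_j\in\mathcal{N}$ and only finitely many $a_j\neq0$. If $P$ is irreducible with root $\beta$ (so $\mathcal{R}\cong\mathbb{Z}[\beta]$), one writes $(\beta,\mathcal{N})$ for $(P,\mathcal{N})$. Here $-m+\zeta_k$ has minimal polynomial $P(X)=\Phi_k(X+m)$, whose constant term is $\Phi_k(m)$. *)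

(* Defs.v *)
From mathcomp Require Import all_boot all_order all_algebra all_field.

Set Implicit Arguments.
Unset Strict Implicit.
Unset Printing Implicit Defensive.

Import Order.TTheory GRing.Theory Num.Theory.
Local Open Scope ring_scope.

Definition digit_set (b : nat) : {pred int} := [pred a | 0 <= a < b%:Z].

(* A digit sequence with finitely many nonzero terms is a polynomial a over    *)
(* int.  The first two conjuncts ensure that {poly %/ P} is really Z[X]/(P):   *)
(* otherwise qpoly.v quotients by 'X.                                          *)
Definition canonical_number_system (P : {poly int}) (N : {pred int}) : Prop :=
  [/\ P \is monic, (1 < size P)%N, N =i digit_set `|(P`_0)%R|%N
    & forall gamma : {poly %/ P}, exists! a : {poly int},
        (forall j : nat, a`_j \in N) /\
        gamma = \sum_(j < size a) a`_j *: 'qX ^+ j].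

(* (beta, N) stands for (P, N), with P the minimal polynomial of beta over Q;  *)
(* the existence of P in {poly int} says that beta is an algebraic integer.    *)
Definition canonical_number_system_of (beta : algC) (N : {pred int}) : Prop :=
  exists P : {poly int},
    map_poly intr P = minCpoly beta /\ canonical_number_system P N.

(* Main.v *)
(* The minimal polynomial of -m + zeta is P = Phi_k(X + m) = sum_i p_i X^i.    *)
(* First, p_(i+1) <= p_i.  With r = m - 1 and n = deg Q, the operator          *)
(* E(Q) = n Q - (X + r) Q' is a derivation on graded products, so the property *)
(* "Q and E(Q) have nonnegative coefficients" is multiplicative.  It holds for *)
(* the real quadratic factors of P, given by conjugate pairs of roots, hence   *)
(* for P, and reads r (i + 1) p_(i+1) <= (n - i) p_i <= r p_i as n <= r.       *)
(* Second (Kovacs), if the p_i are nonincreasing then (X - 1) P rewrites the   *)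
(* digit p_0 as a combination of X, X^2, ... with nonnegative coefficients of  *)
(* sum p_0.  Since -1 = P - 1 modulo P, every class has a representative A     *)
(* with nonnegative coefficients; carrying and removing the lowest digit keeps *)
(* this, bounds the degree, and lowers A(1) by the digit removed.  If all the  *)
(* digits were 0 from some point on, two representatives would coincide, so    *)
(* the class e would satisfy X^n e = e for some n > 0; as |-m + zeta| > 1,     *)
(* this forces e = 0.                                                          *)

Require Import Defs.
From mathcomp Require Import all_boot all_order all_algebra all_field.
From mathcomp Require Import ring lra zify.

Set Implicit Arguments.
Unset Strict Implicit.

Import Order.TTheory GRing.Theory Num.Theory.
Local Open Scope ring_scope.

(** By [kovacs], a monic P with nonincreasing coefficients gives a canonical number system once
    multiplication by X on Z[X]/(P) has no nonzero periodic point: expansions exist by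
    [nneg_digit_expansion] and are unique by [small_multiple_eq0]. For P = Phi_k(X + m),
    monotonicity follows from [polar_nneg_cyclotomic] and [polar_nneg_coef_dec] with r = m - 1;
    their condition deg P <= r is the hypothesis on m. Periodic points are excluded by
    [qpoly_aperiodic], since |-m + zeta| >= m - 1 > 1. *)

Definition nneg_coef (R : numDomainType) (p : {poly R}) := forall i, 0 <= p`_i.

Lemma nneg_coefD (R : numDomainType) (p q : {poly R}) :
  nneg_coef p -> nneg_coef q -> nneg_coef (p + q).
Proof. by move=> p0 q0 i; rewrite coefD addr_ge0. Qed.

Lemma nneg_coefM (R : numDomainType) (p q : {poly R}) :
  nneg_coef p -> nneg_coef q -> nneg_coef (p * q).
Proof. by move=> p0 q0 i; rewrite coefM sumr_ge0 // => j _; rewrite mulr_ge0. Qed.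

Lemma coef_le_horner1 (A : {poly int}) i :
  nneg_coef A -> A`_i <= A.[1].
Proof.
move=> A0; have [sA|sA] := leqP (size A) i.
  rewrite nth_default // horner_coef sumr_ge0 // => j _.
  by rewrite expr1n mulr1 A0.
rewrite horner_coef (bigD1 (Ordinal sA)) //= expr1n mulr1 lerDl sumr_ge0 //.
by move=> j _; rewrite expr1n mulr1 A0.
Qed.

(** * Carrying with nonnegative coefficients *)

Section Carry.

Variable P : {poly int}.
Hypotheses (P0 : 0 < P`_0) (P_dec : forall i, P`_i.+1 <= P`_i).

Let digit := digit_set `|(P`_0)%R|%N.

Lemma in_digit a : (a \in digit) = (0 <= a < P`_0).
Proof. by rewrite inE /= gez0_abs // ltW. Qed.

(** Adding q (X - 1) P, with q the quotient of A_0 by P_0, leaves the remainder as lowest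
    coefficient; this is what lies above it, divided by X. The fixed bound D keeps all iterates in
    one finite-rank module. *)
Definition carry (D : nat) (A : {poly int}) : {poly int} :=
  \poly_(i < D) (A`_i.+1 + (A`_0 %/ P`_0)%Z * (P`_i - P`_i.+1)).

Variable D : nat.
Hypothesis sPD : (size P <= D)%N.

Lemma carryE (A : {poly int}) : (size A <= D)%N ->
  A + (A`_0 %/ P`_0)%Z%:P * (('X - 1) * P) =
    (A`_0 %% P`_0)%Z%:P + 'X * carry D A.
Proof.
move=> sA; apply/polyP=> i; rewrite mulrBl mul1r.
rewrite !coefD coefCM coefB !coefXM coefC coef_poly.
case: i => [|i] /=.
  have := divz_eq A`_0 P`_0; move: (A`_0 %/ _)%Z (A`_0 %% _)%Z => q r ->; ring.
rewrite add0r; case: ltnP => [//|Di].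
by rewrite [A`__]nth_default ?[P`_i]nth_default ?[P`_i.+1]nth_default ?subrr
  ?mulr0 ?addr0 // ?(leq_trans sPD) ?(leq_trans sA) // ltnW.
Qed.

Lemma carry_nneg (A : {poly int}) :
  nneg_coef A -> nneg_coef (carry D A).
Proof.
move=> A0 i; rewrite coef_poly; case: ifP => // _.
by rewrite addr_ge0 // mulr_ge0 ?subr_ge0 // divz_ge0.
Qed.

Variables (S : comNzRingType) (phi : {rmorphism {poly int} -> S}).
Hypothesis phiP : phi P = 0.
Hypothesis phi_aperiodic :
  forall n e, (0 < n)%N -> phi 'X ^+ n * e = e -> e = 0.

Lemma carry_phi (A : {poly int}) : (size A <= D)%N ->
  phi A = phi (A`_0 %% P`_0)%Z%:P + phi 'X * phi (carry D A).
Proof.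
move=> sA; have /(congr1 phi) := carryE sA.
by rewrite !(rmorphD, rmorphM) /= phiP !mulr0 addr0.
Qed.

Lemma carry_horner1 (A : {poly int}) : (size A <= D)%N ->
  A.[1] = (A`_0 %% P`_0)%Z + (carry D A).[1].
Proof.
move=> sA; have /(congr1 (horner^~ 1)) := carryE sA.
by rewrite !(hornerD, hornerN, hornerM, hornerC, hornerX) subrr mul0r mulr0 addr0 mul1r.
Qed.

(** Strong induction on A(1), resumed just after the first nonzero digit: by [carry_horner1], A(1)
    drops by that digit. *)
Lemma nneg_digit_expansion (A : {poly int}) :
    nneg_coef A -> (size A <= D)%N ->
  exists2 a : {poly int}, (forall j, a`_j \in digit) & phi a = phi A.
Proof.
have [L] := ubnP `|(A.[1])%R|%N; elim: L A => // L IH A LA A0 sA.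
have [phiA|phiA] := eqVneq (phi A) 0.
  by exists 0; rewrite ?rmorph0 // => j; rewrite coef0 in_digit lexx.
pose An n := iter n (carry D) A.
have An0 n : nneg_coef (An n).
  by elim: n => //= n; apply: carry_nneg.
have sAn n : (size (An n) <= D)%N by case: n => //= n; apply: size_poly.
pose r n := ((An n)`_0 %% P`_0)%Z.
have zero_digits n : (forall i, (i < n)%N -> r i = 0) ->
    phi A = phi 'X ^+ n * phi (An n) /\ A.[1] = (An n).[1].
  elim: n => [|n IHn] rn; first by rewrite expr0 mul1r.
  have [-> ->] := IHn (fun i lin => rn i (ltnW lin)).
  rewrite (carry_phi (sAn n)) (carry_horner1 (sAn n)) -/(r n) rn //.
  by rewrite rmorph0 !add0r exprSr mulrA.
have [n rn] : exists n, r n != 0.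
  (* Zero digits leave A(1) unchanged, and A(1) bounds every coefficient, so such iterates take at
     most #|T| values. *)
  pose T : finType := {ffun 'I_D -> 'I_(L.+1)}.
  have [/existsP[n rn]|/existsPn r0] := boolP [exists n : 'I_(#|T|.+1), r n != 0].
    by exists n.
  have {}r0 i : (i < #|T|.+1)%N -> r i = 0.
    by move=> lti; have := r0 (Ordinal lti) => /negPn/eqP.
  pose g (i : 'I_(#|T|.+1)) : T := [ffun k : 'I_D => inord `|((An i)`_k)%R|%N].
  have g_An i j : g i = g j -> An i = An j.
    move=> gij; apply/polyP=> k; have [Dk|kD] := leqP D k.
      by rewrite !nth_default // (leq_trans (sAn _)).
    have /(congr1 val) := congr1 (fun h : T => h (Ordinal kD)) gij.
    have bound (l : 'I_(#|T|.+1)) : (`|((An l)`_k)%R| < L.+1)%N.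
      have [|_ A1] := zero_digits l.
        by move=> i' ltl; apply/r0/(ltn_trans ltl).
      have := coef_le_horner1 k (An0 l); rewrite -A1.
      have : 0 <= (An l)`_k by exact: An0.
      by move: LA; lia.
    rewrite !ffunE /= !inordK //.
    by move=> eij; rewrite -(gez0_abs (An0 i k)) eij gez0_abs ?An0.
  have /injectivePn[i [j nij gij]] : ~~ injectiveb g.
    apply/negP => /injectiveP/leq_card; rewrite card_ord ltnn //.
  case/negP: phiA; apply/eqP.
  have {nij gij} [i' [j' [ltij ltj AA]]] : exists i' j',
      [/\ (i' < j')%N, (j' < #|T|.+1)%N & An i' = An j'].
    case: (ltngtP i j) => [ij|ji|/val_inj eij].
    - by exists i, j; split=> //; apply: g_An.
    - by exists j, i; split=> //; apply: g_An.
    - by rewrite eij eqxx in nij.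
  have r0' n : (n <= j')%N -> forall l, (l < n)%N -> r l = 0.
    by move=> nj l ln; apply/r0/(leq_ltn_trans _ ltj)/(leq_trans (ltnW ln)).
  have [phi_i _] := zero_digits _ (r0' _ (ltnW ltij)).
  have [phi_j _] := zero_digits _ (r0' _ (leqnn _)).
  (* With x = [phi 'X], phi A equals both x^i' phi(An i') and x^j' phi(An j'), and these two
     iterates agree. *)
  apply: (phi_aperiodic (n := (j' - i')%N)); first by rewrite subn_gt0.
  by rewrite {1}phi_i mulrA -exprD subnK ?(ltnW ltij) // AA -phi_j.
case: (ex_minnP (ex_intro (fun n => r n != 0) n rn)) => {rn} {}n rn min_n.
have {}min_n i : (i < n)%N -> r i = 0.
  by move=> lin; apply/eqP; apply: contraTT lin => /min_n; rewrite -leqNgt.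
have [phiAn A1] := zero_digits _ min_n.
have rn0 : 0 <= r n by apply: modz_ge0; rewrite gt_eqF.
have rnP : r n < P`_0 by apply: ltz_pmod.
have [] := IH (An n.+1) _ (An0 _) (sAn _).
  rewrite -ltnS (leq_trans _ LA) // ltnS.
  have := carry_horner1 (sAn n); rewrite -A1 -/(r n) -[carry D _]/(An n.+1).
  have : 0 <= (An n.+1).[1].
    by apply: le_trans (coef_le_horner1 0 (An0 _)); apply: An0.
  by move: rn rn0; lia.
move=> a a_digit phia; exists ('X^n * ((r n)%:P + 'X * a)).
  move=> j; rewrite coefXnM coefD coefC coefXM.
  case: ltnP => _; first by rewrite in_digit lexx.
  case: eqP => _; first by rewrite addr0 in_digit rn0.
  by rewrite add0r.
rewrite phiAn (carry_phi (sAn n)) !(rmorphM, rmorphD, rmorphXn) /=.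
by rewrite phia.
Qed.

End Carry.

(** * Kovacs' criterion in Z[X]/(P) *)

(** If c is the lowest nonzero coefficient of C, then c P_0 is a coefficient of C P, of absolute
    value at least |P_0|. *)
Lemma small_multiple_eq0 (P C : {poly int}) :
  (forall j, `|(C * P)`_j| < `|P`_0|) -> C = 0.
Proof.
move=> small; apply/polyP=> j; rewrite coef0.
elim/ltn_ind: j => j IH; have := small j.
rewrite coefM big_ord_recr /= subnn big1 ?add0r => [|i _]; last first.
  by rewrite IH ?mul0r.
by rewrite normrM; nia.
Qed.

Lemma qpoly_sum_coef (R : comNzRingType) (P a : {poly R}) :
  \sum_(j < size a) a`_j *: ('qX : {poly %/ P}) ^+ j = in_qpoly P a.
Proof.
rewrite -[a in RHS]coefK poly_def raddf_sum /=; apply: eq_bigr => i _.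
by rewrite in_qpolyZ rmorphXn.
Qed.

Lemma in_qpoly_eq0 (P E : {poly int}) : P \is monic -> (1 < size P)%N ->
  in_qpoly P E = 0 -> exists C, E = C * P.
Proof.
move=> monP sP /(congr1 val) /=; rewrite /mk_monic monP sP /= => E0.
exists (Pdiv.Ring.rdivp E P); rewrite {1}[E](Pdiv.RingMonic.rdivp_eq monP) E0 addr0 //.
Qed.

Theorem kovacs (P : {poly int}) : P \is monic -> (1 < size P)%N ->
    (forall i, P`_i.+1 <= P`_i) ->
    (forall n (e : {poly %/ P}), (0 < n)%N -> 'qX ^+ n * e = e -> e = 0) ->
  canonical_number_system P (digit_set `|(P`_0)%R|%N).
Proof.
move=> monP sP P_dec aper; split=> //.
have P_anti i j : P`_(i + j) <= P`_i.
  by elim: j => [|j IH]; rewrite ?addn0 // addnS (le_trans _ IH).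
have P_nneg : nneg_coef P.
  move=> i; apply: le_trans (P_anti i (size P)).
  by rewrite nth_default // leq_addl.
have P_0 : 0 < P`_0.
  have := P_anti 0%N (size P).-1; rewrite add0n -lead_coefE (monicP monP).
  exact: lt_le_trans.
have PE0 : in_qpoly P P = 0.
  by apply: val_inj; rewrite /= /mk_monic monP sP Pdiv.RingMonic.rmodpp.
move=> gamma.
have gammaE : gamma = in_qpoly P (val gamma).
  by apply: val_inj; rewrite /= Pdiv.Ring.rmodp_small ?size_mk_monic.
pose pos := map_poly (Num.max 0) (val gamma).
pose neg := map_poly (fun x => Num.max 0 (- x)) (val gamma).
have posE i : pos`_i = Num.max 0 (val gamma)`_i by rewrite coef_map_id0.
have negE i : neg`_i = Num.max 0 (- (val gamma)`_i).
  by rewrite coef_map_id0 // oppr0.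
have P1_nneg : nneg_coef (P - 1).
  by case=> [|i]; rewrite coefB coef1 subr_ge0 //= P_nneg.
(* [-1 = P - 1] modulo [P] *)
pose A := pos + neg * (P - 1).
have A_nneg : nneg_coef A.
  by apply: nneg_coefD; [|apply: nneg_coefM => //] => i;
    rewrite ?posE ?negE le_max lexx.
have gammaA : gamma = in_qpoly P A.
  rewrite gammaE.
  have -> : A = val gamma + neg * P.
    apply/polyP => i; rewrite /A mulrBr mulr1 !coefD coefN posE negE.
    have max_opp (x : int) : Num.max 0 x = x + Num.max 0 (- x) by lia.
    rewrite [Num.max 0 (val gamma)`_i]max_opp.
    by rewrite -addrA; congr (_ + _); rewrite addrCA subrr addr0.
  by rewrite rmorphD rmorphM /= PE0 mulr0 addr0.
pose D := maxn (size A) (size P).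
have [a a_digit aA] := nneg_digit_expansion P_0 P_dec (leq_maxr _ _ : (_ <= D)%N)
  (phi := in_qpoly P) PE0 aper A_nneg (leq_maxl _ _).
have {}aA : in_qpoly P a = gamma by rewrite gammaA; exact: aA.
exists a; split=> [|b [b_digit bE]].
  by split=> //; rewrite qpoly_sum_coef aA.
(* Two expansions differ by a multiple of P whose coefficients are differences of digits, hence
   below P_0 in absolute value. *)
apply/eqP; rewrite -subr_eq0; apply/eqP.
have [|C abC] := @in_qpoly_eq0 P (a - b) monP sP.
  by rewrite raddfB /= aA {1}bE qpoly_sum_coef subrr.
rewrite abC (@small_multiple_eq0 P C) ?mul0r // => j; rewrite -abC coefB.
have := a_digit j; have := b_digit j; rewrite !in_digit // (gtr0_norm P_0).
by move: a`_j b`_j P`_0 => x y b0 /andP[y0 yb] /andP[x0 xb]; lia.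
Qed.

(** * Polar derivatives with nonnegative coefficients *)

Section Polar.

Variable R : numDomainType.
Implicit Types (r : R) (Q : {poly R}).

(** The polar derivative of Q at the point -r; with n = deg Q, its coefficient of X^i is (n - i) Q_i
    - r (i + 1) Q_(i+1). *)
Definition polar r Q := (size Q).-1%:R *: Q - ('X + r%:P) * Q^`().

Definition polar_nneg r Q :=
  [/\ Q \is monic, nneg_coef Q & nneg_coef (polar r Q)].

Lemma polarM r Q1 Q2 : Q1 \is monic -> Q2 \is monic ->
  polar r (Q1 * Q2) = polar r Q1 * Q2 + Q1 * polar r Q2.
Proof.
move=> mQ1 mQ2; rewrite /polar size_monicM ?monic_neq0 // derivM.
have -> : (size Q1 + size Q2).-1.-1 = ((size Q1).-1 + (size Q2).-1)%N.
  have := monic_neq0 mQ1; have := monic_neq0 mQ2; rewrite -!size_poly_gt0.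
  by case: (size Q1) (size Q2) => [|a] [|b] //= _ _; rewrite addnS.
by rewrite natrD -!mul_polyC polyCD; ring.
Qed.

Lemma polar_nneg1 r : polar_nneg r 1.
Proof.
split; [exact: monic1 | by move=> i; rewrite coef1 ler0n |].
by rewrite /polar size_poly1 derivC scale0r mulr0 subr0 => i; rewrite coef0.
Qed.

Lemma polar_nnegM r Q1 Q2 :
  polar_nneg r Q1 -> polar_nneg r Q2 -> polar_nneg r (Q1 * Q2).
Proof.
move=> [mQ1 nQ1 pQ1] [mQ2 nQ2 pQ2]; split; first by rewrite monicMl.
  exact: nneg_coefM.
by rewrite polarM //; apply: nneg_coefD; apply: nneg_coefM.
Qed.

Lemma polar_nneg_coef_dec r Q i : polar_nneg r Q ->
  (size Q).-1%:R <= r -> 1 <= r -> Q`_i.+1 <= Q`_i.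
Proof.
move=> [mQ nQ pQ] dr r1; have r0 : 0 < r by apply: lt_le_trans r1.
have := pQ i; rewrite /polar coefB coefZ mulrDl coefD coefXM coefCM !coef_deriv.
have -> : (if i == 0%N then 0 else Q`_i.-1.+1 *+ i.-1.+1) = Q`_i *+ i.
  by case: i => [|i]; rewrite ?mulr0n.
rewrite subr_ge0 => h.
rewrite -(ler_pM2l r0); apply: le_trans (ler_wpM2r (nQ i) dr).
apply: le_trans h; apply: ler_wpDl; first exact: mulrn_wge0.
by rewrite ler_pM2l // mulrS lerDl mulrn_wge0.
Qed.

End Polar.

(** With u = 2 - 2 Re w >= 0, the polar derivative is u X + (r + 2) u. A single linear factor would
    give the constant 1 - w, in general not real, hence the pairing. *)
Lemma polar_nneg_conj_pair (C : numClosedFieldType) (r w : C) :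
    `|w| = 1 -> 0 <= r ->
  polar_nneg r (('X + (r + 1 - w)%:P) * ('X + (r + 1 - w^*)%:P)).
Proof.
move=> w1 r0; pose u := 2 - (w + w^*).
have u0 : 0 <= u.
  have := leif_Re_Creal w => -[+ _]; rewrite ReE w1 ler_pdivrMr ?ltr0n //.
  by rewrite mul1r subr_ge0.
have ww : w * w^* = 1 by rewrite -normCK w1 expr1n.
have -> : ('X + (r + 1 - w)%:P) * ('X + (r + 1 - w^*)%:P) =
    'X^2 + (2 * r + u) *: 'X + (r ^+ 2 + (r + 1) * u)%:P.
  rewrite -mul_polyC /u; move: ww; move: (w^*) => v wv.
  (* The identity holds modulo w v = 1, so the defect 1 - w v is split off to leave a formal
     identity. *)
  have -> : r ^+ 2 + (r + 1) * (2 - (w + v)) =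
      (r + 1 - w) * (r + 1 - v) + (1 - w * v) by ring.
  rewrite wv subrr addr0 !(polyCD, polyCM, polyCN).
  ring.
have coefQ (a b : C) i : ('X^2 + a *: 'X + b%:P : {poly C})`_i =
    (i == 2)%:R + a * (i == 1)%:R + (if i == 0 then b else 0).
  by rewrite !coefD coefXn coefZ coefX coefC.
split.
- rewrite -addrA monicE lead_coefDl ?lead_coefXn // size_polyXn.
  by rewrite ltnS -mul_polyC size_MXaddC; case: ifP => // _; rewrite ltnS size_polyC_leq1.
- move=> i; rewrite coefQ.
  have s0 : 0 <= 2 * r + u by rewrite addr_ge0 ?mulr_ge0 ?ler0n.
  have c0 : 0 <= r ^+ 2 + (r + 1) * u.
    by rewrite addr_ge0 ?exprn_ge0 // mulr_ge0 // addr_ge0.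
  by rewrite !addr_ge0 ?ler0n ?mulr_ge0 //; case: ifP.
rewrite /polar.
have -> : size ('X^2 + (2 * r + u) *: 'X + (r ^+ 2 + (r + 1) * u)%:P) = 3.
  rewrite -addrA size_polyDl ?size_polyXn // -mul_polyC size_MXaddC.
  by case: ifP => // _; rewrite !ltnS size_polyC_leq1.
rewrite !derivD derivXn derivZ derivX derivC addr0 /= expr1.
set Q := (X in nneg_coef X).
have -> : Q = u%:P * 'X + ((r + 2) * u)%:P.
  rewrite /Q -!mul_polyC !(polyCD, polyCM, polyCN) -mulr_natl.
  ring.
move=> i; rewrite coefD coefCM coefX coefC addr_ge0 ?mulr_ge0 ?ler0n //.
by case: ifP => // _; rewrite mulr_ge0 // addr_ge0.
Qed.

(** * Conjugate pairs of roots of cyclotomic polynomials *)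

Lemma norm_prim_root (C : numClosedFieldType) k (z : C) :
  k.-primitive_root z -> `|z| = 1.
Proof.
move=> prim_z; have k0 := prim_order_gt0 prim_z.
by apply/eqP; rewrite -(pexpr_eq1 k0) // -normrX (prim_expr_order prim_z) normr1.
Qed.

(** The reflection j -> k - j preserves coprimality to k; a fixed j would have k = 2 j, and
    coprimality would force k = 2. *)
Lemma prod_coprime_pair (R : comNzRingType) k (F : nat -> R) : (2 < k)%N ->
  \prod_(j < k | coprime j k) F j =
  \prod_(j < k | coprime j k && (j.*2 < k)%N) (F j * F (k - j)%N).
Proof.
move=> k2; have k0 : (0 < k)%N by apply: ltn_trans k2.
rewrite (bigID (fun j : 'I_k => (j.*2 < k)%N)) /= big_split /=; congr (_ * _).
(* Reducing modulo k sends 0 to itself and makes the reflection an involution of all of ['I_k]. *)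
pose h (j : 'I_k) := Ordinal (ltn_pmod (k - j) k0).
have hE (j : 'I_k) : (0 < j)%N -> h j = (k - j)%N :> nat.
  by move=> j0; rewrite /= modn_small // ltn_subrL j0.
have hK : involutive h.
  move=> j; apply: ord_inj; have [j0|j0] := posnP j.
    by rewrite /= j0 subn0 modnn subn0 modnn.
  by rewrite hE hE // ?subn_gt0 ?subKn // ltnW.
rewrite (reindex_inj (inv_inj hK)); apply: eq_big => [j|j].
  have [j0|j0] := posnP j.
    rewrite j0 /= j0 subn0 modnn /coprime gcd0n; case: eqP => // k1.
    by rewrite k1 in k2.
  rewrite hE //; have -> : coprime (k - j) k = coprime j k.
    have co_add a c : coprime c (a + c) = coprime a (a + c).
      by rewrite /coprime gcdnDl gcdnDr gcdnC.
    by have := co_add j (k - j)%N; rewrite subnKC // ltnW.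
  case co_jk: (coprime j k) => //=.
  have := ltn_ord j.
  have : j.*2 != k.
    apply/eqP => j2k; have : coprime j j.*2 by rewrite j2k.
    by rewrite /coprime -addnn gcdnDl gcdnn => /eqP j1; rewrite -j2k j1 in k2.
  by lia.
move=> /andP[co _]; rewrite hE //; have [j0|//] := posnP j.
by move: co; rewrite /= j0 subn0 modnn /coprime gcd0n => /eqP k1; rewrite k1 in k2.
Qed.

Lemma polar_nneg_cyclotomic (z : algC) k m :
    (2 < k)%N -> k.-primitive_root z -> (0 < m)%N ->
  polar_nneg (m%:R - 1) (cyclotomic z k \Po ('X + m%:R%:P)).
Proof.
move=> k2 prim_z m0; have z1 := norm_prim_root prim_z.
rewrite /cyclotomic rmorph_prod /=.
rewrite (eq_bigr (fun j : 'I_k => 'X + (m%:R - 1 + 1 - z ^+ j)%:P)); last first.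
  by move=> j _; rewrite comp_polyB comp_polyX comp_polyC subrK polyCB addrA.
rewrite (prod_coprime_pair (fun j => 'X + (m%:R - 1 + 1 - z ^+ j)%:P)) //.
apply: big_ind; [exact: polar_nneg1 | exact: polar_nnegM | move=> j _].
have -> : z ^+ (k - j) = (z ^+ j)^*.
  apply: (@mulfI _ (z ^+ j)); first by rewrite expf_neq0 // -normr_eq0 z1 oner_eq0.
  rewrite -exprD subnKC ?(ltnW (ltn_ord j)) // -normCK normrX z1.
  by rewrite (prim_expr_order prim_z) !expr1n.
apply: polar_nneg_conj_pair; first by rewrite normrX z1 expr1n.
by rewrite subr_ge0 ler1n.
Qed.

(** * Translated minimal polynomials and absence of periodic points *)

Lemma minCpoly_sub (x : algC) (a : rat) :
  minCpoly (x - ratr a) = minCpoly x \Po ('X + (ratr a)%:P).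
Proof.
have [p [-> mp] dvp] := minCpolyP x; have [q [-> mq] dvq] := minCpolyP (x - ratr a).
have sXa (R : nzRingType) (b : R) : size ('X + b%:P) = 2 by rewrite size_XaddC.
have q_dvd : q %| p \Po ('X + a%:P).
  rewrite -dvq map_comp_poly rmorphD /= map_polyX map_polyC /=.
  by rewrite /root horner_comp !hornerE subrK -/(root _ _) dvp.
have p_dvd : p %| q \Po ('X - a%:P).
  rewrite -dvp map_comp_poly rmorphB /= map_polyX map_polyC /=.
  by rewrite /root horner_comp !hornerE -/(root _ _) dvq.
have -> : q = p \Po ('X + a%:P).
  apply/eqP; rewrite -eqp_monic //; last first.
    by rewrite monicE lead_coef_comp ?sXa // lead_coefXaddC expr1n mulr1 -monicE.
  rewrite -dvdp_size_eqp // eqn_leq dvdp_leq //=; last first.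
    by rewrite comp_poly2_eq0 ?sXa // monic_neq0.
  rewrite size_comp_poly2 ?sXa // (leq_trans (dvdp_leq _ p_dvd)) //.
    by rewrite comp_poly2_eq0 ?size_XsubC // monic_neq0.
  by rewrite size_comp_poly2 ?size_XsubC.
by rewrite map_comp_poly rmorphD /= map_polyX map_polyC.
Qed.

(** Evaluating at beta gives (beta^n - 1) e(beta) = 0 with beta^n <> 1, so beta is a root of the
    reduced representative of e, whose degree is below that of its minimal polynomial. *)
Lemma qpoly_aperiodic (P : {poly int}) (beta : algC) :
    map_poly intr P = minCpoly beta -> 1 < `|beta| ->
  forall n (e : {poly %/ P}), (0 < n)%N -> 'qX ^+ n * e = e -> e = 0.
Proof.
move=> Pbeta beta1 n e n0 Xe.
have inj_intr : injective (intr : int -> algC) by exact: intr_inj.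
have monP : P \is monic.
  apply/eqP/inj_intr; rewrite -(lead_coef_map_inj (f := intr)) // Pbeta.
  exact/monicP/minCpoly_monic.
have sP : (1 < size P)%N.
  by rewrite -(size_map_inj_poly inj_intr) // Pbeta size_minCpoly.
have eE : e = in_qpoly P (val e).
  by apply: val_inj; rewrite /= Pdiv.Ring.rmodp_small ?size_mk_monic.
have [|C EC] := @in_qpoly_eq0 P ('X^n * val e - val e) monP sP.
  by rewrite rmorphB rmorphM rmorphXn /= -eE Xe subrr.
have P0 : (map_poly intr P : {poly algC}).[beta] = 0.
  by rewrite Pbeta; apply/eqP/root_minCpoly.
have /(congr1 (fun A : {poly int} => (map_poly intr A : {poly algC}).[beta])) := EC.
rewrite rmorphB !rmorphM /= map_polyXn hornerD hornerN !hornerM hornerXn P0 mulr0.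
rewrite -[X in _ - X]mul1r -mulrBl => /eqP; rewrite mulf_eq0 subr_eq0.
case/orP => [/eqP bn|Ebeta].
  by have := beta1; rewrite -(expr_gt1 n0) // -normrX bn normr1 ltxx.
apply: val_inj; rewrite [RHS]/=; have [p [pE mp] dvp] := minCpolyP beta.
have intE (A : {poly int}) :
    map_poly intr A = map_poly ratr (map_poly intr A : {poly rat}) :> {poly algC}.
  by rewrite -map_poly_comp; apply: eq_map_poly => c /=; rewrite ratr_int.
have sE : (size (val e) < size P)%N.
  by apply: leq_trans (size_mk_monic e) _; rewrite /mk_monic sP monP.
have dvE : p %| (map_poly intr (val e) : {poly rat}) by rewrite -dvp -intE.
move: (val e : {poly int}) sE dvE => E sE; apply: contraTeq => E0.
have sintQ (A : {poly int}) : size (map_poly intr A : {poly rat}) = size A.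
  exact: size_map_inj_poly intr_inj _ _.
apply: contraL sE => /dvdp_leq; rewrite -leqNgt sintQ.
rewrite -size_poly_eq0 sintQ size_poly_eq0 => /(_ E0).
have -> : size p = size (map_poly ratr p : {poly algC}) by rewrite size_map_poly.
by rewrite -pE -Pbeta (size_map_inj_poly inj_intr).
Qed.

Theorem theorem1 (k m : nat) (zeta : algC) :
  (2 < k)%N -> (0 < m)%N -> k.-primitive_root zeta ->
  (totient k + 1 <= m)%N ->
  canonical_number_system_of (- m%:R + zeta)
    (digit_set `|(('Phi_k).[m%:Z])%R|%N).
Proof.
move=> k2 m0 prim_zeta km; pose P := 'Phi_k \Po ('X + m%:Z%:P).
have totient2 : (1 < totient k)%N by rewrite totient_gt1.
have PC : map_poly intr P = cyclotomic zeta k \Po ('X + m%:R%:P).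
  rewrite map_comp_poly (Cintr_Cyclotomic prim_zeta) rmorphD /=.
  by rewrite map_polyX map_polyC.
have Pbeta : map_poly intr P = minCpoly (- m%:R + zeta).
  have -> : - m%:R + zeta = zeta - ratr m%:R by rewrite ratr_nat addrC.
  by rewrite minCpoly_sub (minCpoly_cyclotomic prim_zeta) ratr_nat.
have sP : size P = (totient k).+1.
  by rewrite size_comp_poly2 ?size_XaddC // size_Cyclotomic.
have -> : ('Phi_k).[m%:Z] = P`_0.
  by rewrite -horner_coef0 horner_comp !hornerE.
exists P; split => //; apply: kovacs.
- by rewrite monicE lead_coef_comp ?size_XaddC // lead_coefXaddC expr1n mulr1
    -monicE Cyclotomic_monic.
- by rewrite sP ltnS ltnW.
- move=> i; rewrite -(ler_int algC) -!coef_map /= PC.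
  have r0 := polar_nneg_cyclotomic k2 prim_zeta m0.
  have m1 : m%:R - 1 = m.-1%:R :> algC by rewrite -subn1 natrB.
  apply: (polar_nneg_coef_dec i r0).
    rewrite size_comp_poly2 ?size_XaddC // size_cyclotomic m1 ler_nat.
    by move: km; lia.
  by rewrite m1 ler1n; move: km totient2; lia.
apply: (qpoly_aperiodic Pbeta).
(* |m - zeta| >= m - 1 >= phi(k) >= 2, the last because k > 2. *)
have := lerB_dist (m%:R : algC) zeta.
rewrite distrC [zeta - _]addrC (norm_prim_root prim_zeta) normr_nat.
apply: lt_le_trans.
by rewrite ltrBrDr -[1 + 1]/(2%:R) ltr_nat; move: km totient2; lia.
Qed.
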